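(* The partially observable restless multi-armed bandit described in the context, with discount factor $\beta\in(0,1)$, is indexable if $\beta\le 0.5$.
   Context: There are $N$ independent arms. Each arm (index suppressed; parameters may differ across arms) is a Markov chain with state space $\{0,1,\dots,K-1\}$, transition matrix $\mathbf{P}=(p_{i,j})$ (assumed irreducible and aperiodic) and reward (row) vector $B=[B_0,\dots,B_{K-1}]$ with $0=B_0\le B_1\le\cdots\le B_{K-1}$. Write $p_k$ for the $k$-th row of $\mathbf{P}$, and $'$ for transpose. Only the states of selected arms are observed; the state of an arm for decision purposes is its belief state, a probability row vector $\omega=(\omega_0,\dots,\omega_{K-1})$ on the internal states; the set of all belief states is the simplex $\mathbb{X}$. For a single arm with subsidy $m\in\mathbb{R}$ for passivity: at each time $t=1,2,\dots$ an action $u(t)\in\{0,1\}$ is chosen ($1$ = active, $0$ = passive) on the basis of the current belief state $\omega(t)$. If $u(t)=1$, the internal state $S(t)$, distributed according to $\omega(t)$, is observed, reward $B_{S(t)}$ is received, and $\omega(t+1)=p_{S(t)}$. If $u(t)=0$, the subsidy $m$ is received, nothing is observed, and $\omega(t+1)=\omega(t)\mathbf{P}$. The value function $V_{\beta,m}(\omega)$ is the maximum over policies of $\mathbb{E}[\sum_{t\ge1}\beta^{t-1}(\mathbf{1}(u(t)=1)B_{S(t)}+m\,\mathbf{1}(u(t)=0))\mid\omega(1)=\omega]$; it satisfies $V_{\beta,m}(\omega)=\max\{V_{\beta,m}(\omega;u=1),V_{\beta,m}(\omega;u=0)\}$ with $$V_{\beta,m}(\omega;u=1)=\omega B'+\beta\sum_{k=0}^{K-1}\omega_kV_{\beta,m}(p_k),\qquad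 V_{\beta,m}(\omega;u=0)=m+\beta V_{\beta,m}(\omega\mathbf{P}).$$ The passive set is $P(m)=\{\omega\in\mathbb{X}: V_{\beta,m}(\omega;u=1)\le V_{\beta,m}(\omega;u=0)\}$. The restless multi-armed bandit is indexable if, for each single-armed bandit with subsidy (i.e. for each arm), $P(m)$ increases monotonically (with respect to inclusion) from $\emptyset$ to the whole space $\mathbb{X}$ as $m$ increases from $-\infty$ to $+\infty$. *)

(* Defs.v *)
From HB Require Import structures.
From mathcomp Require Import all_boot all_order all_algebra.
From mathcomp Require Import all_classical all_reals all_analysis.
Set Implicit Arguments.
Unset Strict Implicit.
Unset Printing Implicit Defensive.
Import Order.TTheory GRing.Theory Num.Theory.
Import numFieldNormedType.Exports.
Local Open Scope classical_set_scope.
Local Open Scope ring_scope.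

Section MarkovChain.
Context {R : realType} {K : nat}.
Implicit Types (P : 'M[R]_K) (w : 'rV[R]_K).

Definition belief_space : set 'rV[R]_K :=
  [set w | (forall k, 0 <= w 0 k) /\ \sum_k w 0 k = 1].

Definition stochastic P := forall i, belief_space (row i P).

Definition irreducible P := forall i j, exists n, 0 < (P ^+ n) i j.

(* The gcd of the return times of every state is 1. *)
Definition aperiodic P := forall (i : 'I_K) (d : nat),
  (forall n, (0 < n)%N -> 0 < (P ^+ n) i i -> (d %| n)%N) -> d = 1%N.

(* Probability that the chain started from the law w has s as its initial
   trajectory of internal states, whether or not these states are observed. *)
Fixpoint path_prob P w (s : seq 'I_K) : R :=
  if s is k :: s' then w 0 k * path_prob P (row k P) s' else 1.

End MarkovChain.

Section SingleArm.
Context {R : realType} {K : nat}.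
Variables (beta : R) (P : 'M[R]_K) (B : 'rV[R]_K) (m : R).
Implicit Types (w : 'rV[R]_K).

(* pi t w is the action (true = active) taken at time t + 1 in the belief
   state w; its values outside the simplex are irrelevant. *)
Definition policy := nat -> 'rV[R]_K -> bool.

(* Reward collected, from time t + 1 on and discounted to that time, when w is
   the current belief state and s lists the current and subsequent internal
   states up to the horizon. *)
Fixpoint discounted_reward (pi : policy) (t : nat) w (s : seq 'I_K) : R :=
  if s is k :: s' then
    if pi t w then B 0 k + beta * discounted_reward pi t.+1 (row k P) s'
    else m + beta * discounted_reward pi t.+1 (w *m P) s'
  else 0.

(* Expectations are finite sums over the trajectories up to the horizon T. The
   rewards are bounded, so for 0 <= beta < 1 their limit is the expectation of
   the infinite-horizon discounted reward. *)
Definition policy_value (pi : policy) w : R :=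
  limn (fun T : nat => \sum_(s : T.-tuple 'I_K)
    path_prob P w s * discounted_reward pi 0 w s).

Definition value w : R := sup (range (fun pi : policy => policy_value pi w)).

Definition value_active w : R :=
  (w *m B^T) 0 0 + beta * \sum_k w 0 k * value (row k P).

Definition value_passive w : R := m + beta * value (w *m P).

Definition passive_set : set 'rV[R]_K :=
  [set w | belief_space w /\ value_active w <= value_passive w].

End SingleArm.

Definition indexable_arm {R : realType} {K : nat} (beta : R)
    (P : 'M[R]_K) (B : 'rV[R]_K) : Prop :=
  [/\ forall m1 m2 : R, m1 <= m2 ->
        passive_set beta P B m1 `<=` passive_set beta P B m2,
      \forall m \near -oo, passive_set beta P B m = set0
    & \forall m \near +oo, passive_set beta P B m = belief_space].

Definition indexable {R : realType} {N : nat} {K : 'I_N -> nat} (beta : R)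
    (P : forall a, 'M[R]_(K a)) (B : forall a, 'rV[R]_(K a)) : Prop :=
  forall a, indexable_arm beta (P a) (B a).

(* Main.v *)
(* Under any fixed policy, raising the subsidy from m1 to m2 raises the
   discounted reward by at least 0 and at most (m2 - m1) / (1 - beta), hence so
   does the value function, as a supremum over policies. The advantage of
   passivity therefore grows by at least
   (m2 - m1) - beta * (m2 - m1) / (1 - beta), which is nonnegative as soon as
   beta <= 1 / 2. No Bellman equation is needed. The two limits follow from the
   rewards of the always active and always passive policies. *)
Require Import Defs.
From HB Require Import structures.
From mathcomp Require Import all_boot all_order all_algebra.
From mathcomp Require Import all_classical all_reals all_analysis.
From mathcomp Require Import ring lra.
Import Order.TTheory GRing.Theory Num.Theory.
Import numFieldNormedType.Exports.
Local Open Scope classical_set_scope.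
Local Open Scope ring_scope.

(** * Expectations over trajectories of a finite horizon *)

Section Expectation.
Set Implicit Arguments.
Unset Strict Implicit.
Context {R : realType} {K : nat}.
Implicit Types (w : 'rV[R]_K) (F : seq 'I_K -> R).

Lemma belief_convex_sum_le w (f : 'I_K -> R) (b : R) :
  belief_space w -> (forall k, f k <= b) -> \sum_k w 0 k * f k <= b.
Proof.
move=> [w_ge0 w_sum1] fb; rewrite -[leRHS]mul1r -w_sum1 mulr_suml.
by apply: ler_sum => k _; rewrite ler_wpM2l.
Qed.

Lemma belief_convex_sum_ge w (f : 'I_K -> R) (a : R) :
  belief_space w -> (forall k, a <= f k) -> a <= \sum_k w 0 k * f k.
Proof.
move=> [w_ge0 w_sum1] fa; rewrite -[leLHS]mul1r -w_sum1 mulr_suml.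
by apply: ler_sum => k _; rewrite ler_wpM2l.
Qed.

Context (P : 'M[R]_K) (P_stochastic : stochastic P).

Lemma belief_space_mulmx w : belief_space w -> belief_space (w *m P).
Proof.
move=> [w_ge0 w_sum1].
have rowP i : (forall j, 0 <= P i j) /\ \sum_j P i j = 1.
  have [P_ge0 P_sum1] := P_stochastic i.
  split=> [j|]; first by have := P_ge0 j; rewrite mxE.
  by rewrite -P_sum1; apply: eq_bigr => j _; rewrite mxE.
split=> [k|].
  by rewrite mxE; apply: sumr_ge0 => i _; rewrite mulr_ge0 // (rowP i).1.
under eq_bigr do rewrite mxE.
rewrite exchange_big -w_sum1; apply: eq_bigr => i _ /=.
by rewrite -mulr_sumr (rowP i).2 mulr1.
Qed.

(** [F] takes sequences rather than tuples, so that it can be precomposed with [cons] when the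
    horizon changes. *)
Definition expectation T w F : R :=
  \sum_(s : T.-tuple 'I_K) path_prob P w s * F s.

Lemma expectation0 w F : expectation 0 w F = F [::].
Proof.
rewrite /expectation (big_pred1 [tuple]) => [|s]; first by rewrite /= mul1r.
by rewrite [s]tuple0 /= eqxx.
Qed.

(** First-step analysis: a trajectory splits into head and tail, and the chain restarts from
    [row k P]. Inductions on the horizon rest on this. *)
Lemma expectationS T w F :
  expectation T.+1 w F =
  \sum_k w 0 k * expectation T (row k P) (fun s => F (k :: s)).
Proof.
rewrite /expectation.
under [RHS]eq_bigr do rewrite mulr_sumr.
rewrite pair_big /=.
rewrite (reindex (fun p : 'I_K * T.-tuple 'I_K => [tuple of p.1 :: p.2])) /=.
  by apply: eq_bigr => p _; rewrite mulrA.
exists (fun s : T.+1.-tuple 'I_K => (thead s, [tuple of behead s])) => [[k s]|s] _ /=.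
  by congr pair; apply: val_inj.
by rewrite [RHS]tuple_eta; apply: val_inj.
Qed.

Lemma expectation_affine T w (r c : R) F : belief_space w ->
  expectation T w (fun s => r + c * F s) = r + c * expectation T w F.
Proof.
elim: T w F => [|T IHT] w F w_belief; first by rewrite !expectation0.
rewrite !expectationS.
under eq_bigr do rewrite IHT // mulrDr mulrCA.
by rewrite big_split /= -mulr_suml w_belief.2 mul1r -mulr_sumr.
Qed.

(** The comparison is restricted to sequences of length [T] because the bounds on discounted rewards
    depend on that length. *)
Lemma expectation_le T w F F' : belief_space w ->
  (forall s, size s = T -> F s <= F' s) -> expectation T w F <= expectation T w F'.
Proof.
elim: T w F F' => [|T IHT] w F F' w_belief FF'.
  by rewrite !expectation0 FF'.
rewrite !expectationS; apply: ler_sum => k _; rewrite ler_wpM2l ?w_belief.1 //.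
by apply: IHT => // s sT; rewrite FF' /= ?sT.
Qed.

Lemma expectation_const T w (r : R) : belief_space w -> expectation T w (fun=> r) = r.
Proof.
move=> w_belief; have := @expectation_affine T w r 0 (fun=> 0) w_belief.
rewrite [X in _ = _ + X]mul0r addr0 => {2}<-; apply: eq_bigr => s _.
by rewrite mul0r addr0.
Qed.

End Expectation.

(** * Convergence and bounds for the value of a fixed policy *)

Section PolicyValue.
Set Implicit Arguments.
Unset Strict Implicit.
Context {R : realType} {K : nat}.
Context {beta : R} {P : 'M[R]_K} {B : 'rV[R]_K}.
Context (P_stochastic : stochastic P) (beta_gt0 : 0 < beta) (beta_lt1 : beta < 1).
Implicit Types (w v : 'rV[R]_K) (pi : @policy R K) (m : R) (s : seq 'I_K).

(** Together with [next_belief], this merges the two branches of [discounted_reward] into a single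
    recursion. *)
Definition step_reward m pi t w (k : 'I_K) : R := if pi t w then B 0 k else m.

Definition next_belief pi t w (k : 'I_K) : 'rV[R]_K :=
  if pi t w then row k P else w *m P.

Lemma discounted_reward_cons m pi t w k s :
  discounted_reward beta P B m pi t w (k :: s) =
  step_reward m pi t w k
    + beta * discounted_reward beta P B m pi t.+1 (next_belief pi t w k) s.
Proof. by rewrite /= /step_reward /next_belief; case: (pi t w). Qed.

(* The law [v] of the internal state is decoupled from the belief [w]: after a
   passive step the trajectory goes on from a row of [P], but the belief from
   [w *m P]. *)
Lemma expected_reward_increment m C pi T t v w :
  belief_space v -> (forall t w k, `|step_reward m pi t w k| <= C) ->
  `|expectation P T.+1 v (discounted_reward beta P B m pi t w)
    - expectation P T v (discounted_reward beta P B m pi t w)| <= C * beta ^+ T.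
Proof.
move=> v_belief rC.
have convex_norm (u : 'rV[R]_K) (f : 'I_K -> R) b : belief_space u ->
    (forall k, `|f k| <= b) -> `|\sum_k u 0 k * f k| <= b.
  move=> u_belief fb; apply: le_trans (ler_norm_sum _ _ _) _.
  under eq_bigr do rewrite normrM (ger0_norm (u_belief.1 _)).
  exact: belief_convex_sum_le.
elim: T t v w v_belief => [|T IHT] t v w v_belief.
  rewrite expectationS expectation0 subr0 expr0 mulr1.
  apply: convex_norm => // k.
  by rewrite expectation0 discounted_reward_cons /= mulr0 addr0.
rewrite 2!expectationS -sumrB; under eq_bigr do rewrite -mulrBr.
apply: convex_norm => // k.
have cons_affine n : expectation P n (row k P)
      (fun s => discounted_reward beta P B m pi t w (k :: s)) =
    step_reward m pi t w k + beta * expectation P n (row k P)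
      (discounted_reward beta P B m pi t.+1 (next_belief pi t w k)).
  rewrite -expectation_affine //; apply: eq_bigr => s _.
  by rewrite discounted_reward_cons.
(* Both horizons collect the same first reward, which cancels; [beta] times an increment with a
   shorter horizon remains. *)
rewrite !cons_affine opprD addrACA subrr add0r -mulrBr normrM gtr0_norm // exprS [leRHS]mulrCA.
by apply: ler_wpM2l; [exact: ltW|exact: IHT].
Qed.

Lemma step_reward_bounded m :
  exists C, forall pi t w k, `|step_reward m pi t w k| <= C.
Proof.
(* A sum in place of a maximum bounds both actions at once, uniformly in the policy. *)
exists (`|m| + \sum_k `|B 0 k|) => pi t w k; rewrite /step_reward.
case: ifP => _; last by rewrite lerDl sumr_ge0.
by rewrite (bigD1 k) //= addrCA lerDl addr_ge0 // sumr_ge0.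
Qed.

(** Makes the [limn] in [policy_value] meaningful: the sequence is the series of its increments,
    dominated by a geometric series of ratio [beta]. *)
Lemma cvg_expected_reward m pi w : belief_space w ->
  cvgn (fun T => expectation P T w (discounted_reward beta P B m pi 0 w)).
Proof.
move=> w_belief; have [C rC] := step_reward_bounded m.
set u := (X in cvgn X).
have -> : u = (fun T => u 0%N + series (telescope u) T).
  by apply/funext => T; exact: eq_sum_telescope.
apply: is_cvgD; first exact: is_cvg_cst.
apply: normed_cvg; apply: (@series_le_cvg _ _ (geometric C beta)) => //=.
- move=> T; apply: mulr_ge0; last by rewrite exprn_ge0 // ltW.
  (* [0 <= C] follows from [rC] at any state; without states, the entries of [w] could not sum to
     1. *)
  case: (pickP (fun _ : 'I_K => true)) => [k _|noK].
    exact: le_trans (rC pi 0%N w k).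
  have := w_belief.2; rewrite big_pred0 // => /eqP.
  by rewrite eq_sym oner_eq0.
- by move=> T; exact: expected_reward_increment.
- by apply: is_cvg_geometric_series; rewrite gtr0_norm.
Qed.

Lemma cvg_discount (a : R) : (fun T => a * (1 - beta ^+ T)) @ \oo --> a.
Proof.
rewrite -[X in _ --> X]mulr1 -[X in _ * X]subr0.
apply: cvgMr; apply: cvgB; first exact: cvg_cst.
by apply: cvg_expr; rewrite gtr0_norm.
Qed.

(** The left side is the geometric sum obtained by collecting [a] at each of the [size s] steps. *)
Lemma discounted_reward_ge m pi a t w s :
  (forall t w k, a <= step_reward m pi t w k) ->
  a / (1 - beta) * (1 - beta ^+ size s) <= discounted_reward beta P B m pi t w s.
Proof.
move=> ar; elim: s t w => [|k s IHs] t w; first by rewrite /= subrr mulr0.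
rewrite discounted_reward_cons.
apply: le_trans (lerD (ar t w k) (ler_wpM2l (ltW beta_gt0) (IHs _ _))).
rewrite [size _]/= exprS le_eqVlt; apply/orP; left; apply/eqP; field.
by rewrite subr_eq0 gt_eqF.
Qed.

Lemma discounted_reward_le m pi b t w s :
  (forall t w k, step_reward m pi t w k <= b) ->
  discounted_reward beta P B m pi t w s <= b / (1 - beta) * (1 - beta ^+ size s).
Proof.
move=> rb; elim: s t w => [|k s IHs] t w; first by rewrite /= subrr mulr0.
rewrite discounted_reward_cons.
apply: le_trans (lerD (rb t w k) (ler_wpM2l (ltW beta_gt0) (IHs _ _))) _.
rewrite [size _]/= exprS le_eqVlt; apply/orP; left; apply/eqP; field.
by rewrite subr_eq0 gt_eqF.
Qed.

Lemma policy_value_ge m pi a w : belief_space w ->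
  (forall t w k, a <= step_reward m pi t w k) ->
  a / (1 - beta) <= policy_value beta P B m pi w.
Proof.
move=> w_belief ar; rewrite -(cvg_lim _ (@cvg_discount (a / (1 - beta)))) //.
apply: ler_lim; [by apply: cvgP; exact: cvg_discount|exact: cvg_expected_reward|].
apply: nearW => T; rewrite -[leLHS](@expectation_const _ _ P P_stochastic T w) //.
by apply: expectation_le => // s <-; exact: discounted_reward_ge.
Qed.

Lemma policy_value_le m pi b w : belief_space w ->
  (forall t w k, step_reward m pi t w k <= b) ->
  policy_value beta P B m pi w <= b / (1 - beta).
Proof.
move=> w_belief rb; rewrite -(cvg_lim _ (@cvg_discount (b / (1 - beta)))) //.
apply: ler_lim; [exact: cvg_expected_reward|by apply: cvgP; exact: cvg_discount|].
apply: nearW => T; rewrite -[leRHS](@expectation_const _ _ P P_stochastic T w) //.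
by apply: expectation_le => // s <-; exact: discounted_reward_le.
Qed.

(** With the policy fixed, both subsidies produce the same actions and beliefs, so each step
    contributes a difference of 0 or [m2 - m1]. The bound solves [L = (m2 - m1) + beta * L], so the
    induction closes independently of the horizon. *)
Lemma discounted_reward_subsidy m1 m2 pi t w s : m1 <= m2 ->
  0 <= discounted_reward beta P B m2 pi t w s - discounted_reward beta P B m1 pi t w s
    <= (m2 - m1) / (1 - beta).
Proof.
move=> m12; have beta1 : 0 < 1 - beta by rewrite subr_gt0.
have L_ge0 : 0 <= (m2 - m1) / (1 - beta) by rewrite divr_ge0 ?subr_ge0 // ltW.
elim: s t w => [|k s IHs] t w; first by rewrite /= subrr lexx.
rewrite !discounted_reward_cons.
have /andP[r_ge0 r_le] :
    0 <= step_reward m2 pi t w k - step_reward m1 pi t w k <= m2 - m1.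
  rewrite /step_reward; case: ifP => _; last by rewrite subr_ge0 m12 lexx.
  by rewrite subrr lexx subr_ge0.
have /andP[d_ge0 d_le] := IHs t.+1 (next_belief pi t w k).
have beta_ge0 := ltW beta_gt0.
rewrite opprD addrACA -mulrBr addr_ge0 ?mulr_ge0 //=.
apply: le_trans (lerD r_le (ler_wpM2l (ltW beta_gt0) d_le)) _.
rewrite le_eqVlt; apply/orP; left; apply/eqP; field.
by rewrite gt_eqF.
Qed.

Lemma policy_value_subsidy m1 m2 pi w : belief_space w -> m1 <= m2 ->
  policy_value beta P B m1 pi w <= policy_value beta P B m2 pi w
    <= policy_value beta P B m1 pi w + (m2 - m1) / (1 - beta).
Proof.
move=> w_belief m12.
pose u m T := expectation P T w (discounted_reward beta P B m pi 0 w).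
have cvg_u m : cvgn (u m) by exact: cvg_expected_reward.
apply/andP; split.
  apply: ler_lim; [exact: cvg_u|exact: cvg_u|].
  apply: nearW => T; apply: expectation_le => // s _.
  by have /andP[+ _] := discounted_reward_subsidy pi 0 w s m12; rewrite subr_ge0.
have shift_cvg : (fun T => u m1 T + (m2 - m1) / (1 - beta)) @ \oo -->
    limn (u m1) + (m2 - m1) / (1 - beta) by apply: cvgD => //; exact: cvg_cst.
rewrite -(cvg_lim _ shift_cvg) //.
apply: ler_lim; [exact: cvg_u|by apply: cvgP; exact: shift_cvg|].
(* The factor 1 brings the shifted expectation into the form of [expectation_affine]. *)
apply: nearW => T; rewrite addrC -[u m1 T]mul1r -expectation_affine //.
apply: expectation_le => // s _.
have /andP[_ +] := discounted_reward_subsidy pi 0 w s m12.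
by rewrite mul1r lerBlDr.
Qed.

End PolicyValue.

(** * Bounds on the value function by suprema over policies *)

Section Value.
Set Implicit Arguments.
Unset Strict Implicit.
Context {R : realType} {K : nat}.
Context {beta : R} {P : 'M[R]_K} {B : 'rV[R]_K}.
Context (P_stochastic : stochastic P) (beta_gt0 : 0 < beta) (beta_lt1 : beta < 1).
Implicit Types (w : 'rV[R]_K) (m : R).

Lemma value_le m b w : belief_space w -> (forall k, B 0 k <= b) -> m <= b ->
  value beta P B m w <= b / (1 - beta).
Proof.
move=> w_belief Bb mb; apply: ge_sup.
  (* Any policy would do: [ge_sup] only asks for a nonempty set. *)
  by exists (policy_value beta P B m (fun _ _ => true) w), (fun _ _ => true).
move=> _ [pi _ <-]; apply: policy_value_le => // t u k.
by rewrite /step_reward; case: ifP.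
Qed.

(** The supremum dominates because the policy values are bounded above, by a step-reward bound that
    is uniform in the policy. *)
Lemma policy_value_le_value m pi w : belief_space w ->
  policy_value beta P B m pi w <= value beta P B m w.
Proof.
move=> w_belief; apply: ub_le_sup; last by exists pi.
have [C rC] := step_reward_bounded (B := B) m.
exists (C / (1 - beta)) => _ [pi' _ <-].
by apply: policy_value_le => // t u k; apply: le_trans (ler_norm _) _.
Qed.

Lemma value_subsidy m1 m2 w : belief_space w -> m1 <= m2 ->
  value beta P B m1 w <= value beta P B m2 w
    <= value beta P B m1 w + (m2 - m1) / (1 - beta).
Proof.
move=> w_belief m12.
have nonempty m : range (fun pi => policy_value beta P B m pi w) !=set0.
  by exists (policy_value beta P B m (fun _ _ => true) w), (fun _ _ => true).
apply/andP; split; apply: ge_sup => // _ [pi _ <-];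
  have /andP[mono lip] :=
    policy_value_subsidy (B := B) P_stochastic beta_gt0 beta_lt1 pi w_belief m12.
- by apply: le_trans mono _; exact: policy_value_le_value.
- by apply: le_trans lip _; rewrite lerD2r policy_value_le_value.
Qed.

(** The always active policy never collects the subsidy, so [m] may be negative. *)
Lemma value_ge0 m w : belief_space w -> (forall k, 0 <= B 0 k) ->
  0 <= value beta P B m w.
Proof.
move=> w_belief B_ge0.
apply: le_trans (@policy_value_le_value m (fun _ _ => true) w w_belief).
by rewrite -[leLHS](mul0r (1 - beta)^-1); apply: policy_value_ge.
Qed.

Lemma value_ge_subsidy m w : belief_space w ->
  m / (1 - beta) <= value beta P B m w.
Proof.
move=> w_belief.
apply: le_trans (@policy_value_le_value m (fun _ _ => false) w w_belief).
exact: policy_value_ge.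
Qed.

End Value.

(** * Indexability of a single arm and of the bandit *)

Lemma indexable_arm_le_half {R : realType} {K : nat} (beta : R) (P : 'M[R]_K)
    (B : 'rV[R]_K) :
  stochastic P -> (forall k, 0 <= B 0 k) -> 0 < beta -> beta <= 2^-1 ->
  indexable_arm beta P B.
Proof.
move=> P_stochastic B_ge0 beta_gt0 beta_le_half.
have beta_lt1 : beta < 1 by lra.
have beta1 : 0 < 1 - beta by rewrite subr_gt0.
pose b := \sum_k B 0 k.
have Bb k : B 0 k <= b by rewrite /b (bigD1 k) //= lerDl sumr_ge0.
have b_ge0 : 0 <= b by apply: sumr_ge0.
have rewardE w : (w *m B^T) 0 0 = \sum_k w 0 k * B 0 k.
  by rewrite mxE; apply: eq_bigr => k _; rewrite mxE.
split.
- move=> m1 m2 m12 w [w_belief passive1]; split=> //.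
  rewrite /value_active /value_passive in passive1 *.
  have wP_belief := belief_space_mulmx P_stochastic w_belief.
  have /andP[passive_mono _] :=
    value_subsidy (B := B) P_stochastic beta_gt0 beta_lt1 wP_belief m12.
  have active_lip : \sum_k w 0 k * value beta P B m2 (row k P) <=
      \sum_k w 0 k * value beta P B m1 (row k P) + (m2 - m1) / (1 - beta).
    rewrite -lerBlDl -sumrB; under eq_bigr do rewrite -mulrBr.
    apply: belief_convex_sum_le => // k; rewrite lerBlDl.
    by have /andP[] :=
      value_subsidy (B := B) P_stochastic beta_gt0 beta_lt1 (P_stochastic k) m12.
  (* [beta <= 1 / 2] enters only here, as [beta / (1 - beta) <= 1]. *)
  have lip_le : beta * ((m2 - m1) / (1 - beta)) <= m2 - m1.
    rewrite mulrA ler_pdivrMr // mulrC ler_wpM2l ?subr_ge0 //; lra.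
  have := ler_wpM2l (ltW beta_gt0) active_lip.
  have := ler_wpM2l (ltW beta_gt0) passive_mono.
  by rewrite mulrDr; lra.
- near=> m; apply/seteqP; split=> // w [w_belief]; apply/negP; rewrite -ltNge.
  rewrite /value_active /value_passive rewardE.
  (* Below this threshold passivity is worth at most [m + beta * (b / (1 - beta)) < 0], while
     activity is worth at least 0. *)
  have m_small : m < - (beta * (b / (1 - beta))).
    by near: m; apply: nbhs_ninfty_lt; exact: num_real.
  have b'_ge0 : 0 <= beta * (b / (1 - beta)).
    by rewrite mulr_ge0 ?divr_ge0 // ltW.
  have wP_belief := belief_space_mulmx P_stochastic w_belief.
  have V_le : value beta P B m (w *m P) <= b / (1 - beta).
    by apply: value_le => //; lra.
  have reward_ge0 : 0 <= \sum_k w 0 k * B 0 k by exact: belief_convex_sum_ge.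
  have V_ge0 : 0 <= \sum_k w 0 k * value beta P B m (row k P).
    by apply: belief_convex_sum_ge => // k; exact: value_ge0.
  have := ler_wpM2l (ltW beta_gt0) V_le.
  have := mulr_ge0 (ltW beta_gt0) V_ge0; lra.
- near=> m; apply/seteqP; split=> [w []//|w w_belief]; split=> //.
  rewrite /value_active /value_passive rewardE.
  (* Once [m] dominates every reward, no continuation value exceeds [m / (1 - beta)], which
     permanent passivity attains; passivity then wins both now and later. *)
  have b_le_m : b <= m.
    by near: m; apply: nbhs_pinfty_ge; exact: num_real.
  have reward_le : \sum_k w 0 k * B 0 k <= b by exact: belief_convex_sum_le.
  have V_le : \sum_k w 0 k * value beta P B m (row k P) <= m / (1 - beta).
    apply: belief_convex_sum_le => // k; apply: value_le => // j.
    exact: le_trans b_le_m.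
  have V_ge : m / (1 - beta) <= value beta P B m (w *m P).
    by apply: value_ge_subsidy => //; exact: belief_space_mulmx.
  have := ler_wpM2l (ltW beta_gt0) (le_trans V_le V_ge); lra.
Unshelve. all: by end_near.
Qed.

Theorem theorem2 (R : realType) (N : nat) (K : 'I_N -> nat)
  (P : forall a, 'M[R]_(K a)) (B : forall a, 'rV[R]_(K a)) (beta : R)
  (K_gt0 : forall a, (0 < K a)%N)
  (P_stochastic : forall a, stochastic (P a))
  (P_irreducible : forall a, irreducible (P a))
  (P_aperiodic : forall a, aperiodic (P a))
  (B_first : forall a (k : 'I_(K a)), k = 0%N :> nat -> B a 0 k = 0)
  (B_nondecreasing : forall a (j k : 'I_(K a)),
     (j <= k)%N -> B a 0 j <= B a 0 k)
  (beta_gt0 : 0 < beta) (beta_lt1 : beta < 1) (beta_le_half : beta <= 2^-1) :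
  indexable beta P B.
Proof.
move=> a; apply: indexable_arm_le_half => // k.
(* Nonnegativity of the rewards: state 0, present by [K_gt0], has reward 0 and the rewards increase
   from there. *)
by rewrite -(B_first a (Ordinal (K_gt0 a)) erefl) B_nondecreasing.
Qed.
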